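(* Let $f:\mathbb{R}^n\to\mathbb{R}$ be convex and twice continuously differentiable, let $A\in\mathbb{R}^{m\times n}$ have full row rank $m$, let $b\in\mathbb{R}^m$, $0\le s\le n$, $\tfrac12\le\gamma<1$, $t_0\ge 0$, $\sigma_1>0$, $\sigma_2>0$, and assume that the problem (P) $\min\{f(x): Ax=b,\ x_i\ge 0,\ i=1,\dots,s\}$ has an optimal solution. Let $(x^0,y^0)\in\mathbb{R}^n_{s++}\times\mathbb{R}^m$ and let $(x(t),y(t))$, $t\in[t_0,+\infty)$, be the solution of the ODE system $$\frac{dx}{dt}=-U(x)^2\left[\nabla f(x)+A^Ty+\sigma_1A^T(Ax-b)\right],\quad x(t_0)=x^0,\qquad \frac{dy}{dt}=\sigma_2(Ax-b),\quad y(t_0)=y^0 .$$ Then for any $(x^{(1)},y^{(1)})\in\Omega^1(x^0,y^0)$, $x^{(1)}$ is an optimal solution of problem (P).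
   Context: Notation: $\mathbb{R}^n_{s++}=\{x\in\mathbb{R}^n: x_i>0,\ 1\le i\le s\}$. For $x\in\mathbb{R}^n_{s++}$, $U(x)=\mathrm{diag}(u)\in\mathbb{R}^{n\times n}$ with $u_i=x_i^{\gamma}$ for $1\le i\le s$ and $u_i=1$ for $s+1\le i\le n$. The ODE system is considered on $\mathbb{R}^n_{s++}\times\mathbb{R}^m$; its solution exists, is unique, and is defined on all of $[t_0,+\infty)$. Limit set: $\Omega^1(x^0,y^0)$ is the set of $(p_1,p_2)\in\mathbb{R}^n\times\mathbb{R}^m$ for which there is a sequence $t_k\to+\infty$ with $(x(t_k),y(t_k))\to(p_1,p_2)$. *)

(* Defs.v *)
From mathcomp Require Import all_boot all_order all_algebra.
From mathcomp Require Import all_classical all_reals all_analysis.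

Set Implicit Arguments.
Unset Strict Implicit.
Unset Printing Implicit Defensive.

Import Order.TTheory GRing.Theory Num.Theory.
Import numFieldNormedType.Exports.

Local Open Scope classical_set_scope.
Local Open Scope ring_scope.

Definition gradient (R : realType) (n : nat) (f : 'cV[R]_n -> R)
    (x : 'cV[R]_n) : 'cV[R]_n :=
  \col_(i < n) 'D_(delta_mx i 0) f x.

Definition hessian (R : realType) (n : nat) (f : 'cV[R]_n -> R)
    (x : 'cV[R]_n) : 'M[R]_n :=
  \matrix_(i < n, j < n) ('D_(delta_mx j 0) (gradient f) x) i 0.

Definition twice_continuously_differentiable (R : realType) (n : nat)
    (f : 'cV[R]_n -> R) : Prop :=
  [/\ forall x, differentiable f x,
      forall x, differentiable (gradient f) x
    & continuous (hessian f)].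

(* Indices start at 0, so that the constrained coordinates 1, ..., s are the
   i : 'I_n with i < s. *)
Definition feasible (R : realType) (m n : nat) (A : 'M[R]_(m, n))
    (b : 'cV[R]_m) (s : nat) : set 'cV[R]_n :=
  [set x | A *m x = b /\ forall i : 'I_n, (i < s)%N -> 0 <= x i 0].

Definition optimal_solution (R : realType) (m n : nat) (f : 'cV[R]_n -> R)
    (A : 'M[R]_(m, n)) (b : 'cV[R]_m) (s : nat) (x : 'cV[R]_n) : Prop :=
  feasible A b s x /\ forall z, feasible A b s z -> f x <= f z.

Definition pos_region (R : realType) (n s : nat) : set 'cV[R]_n :=
  [set x | forall i : 'I_n, (i < s)%N -> 0 < x i 0].

Definition Umx (R : realType) (n s : nat) (gamma : R) (x : 'cV[R]_n) :
    'M[R]_n :=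
  diag_mx (\row_(i < n) (if (i < s)%N then x i 0 `^ gamma else 1)).

(* z' is the derivative of z on [t0, +oo[, one-sided at the endpoint t0. *)
Definition is_derivative_from (R : realType) (V : normedModType R) (t0 : R)
    (z z' : R -> V) : Prop :=
  (forall t, t0 < t -> is_derive t 1 z (z' t)) /\
  (fun h : R => h^-1 *: (z (h + t0) - z t0)) @ 0^'+ --> z' t0.

Definition ode_solution (R : realType) (m n : nat) (f : 'cV[R]_n -> R)
    (A : 'M[R]_(m, n)) (b : 'cV[R]_m) (s : nat)
    (gamma t0 sigma1 sigma2 : R) (x0 : 'cV[R]_n) (y0 : 'cV[R]_m)
    (x : R -> 'cV[R]_n) (y : R -> 'cV[R]_m) : Prop :=
  [/\ forall t, t0 <= t -> pos_region s (x t),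
      is_derivative_from t0 x (fun t =>
        - ((Umx s gamma (x t) *m Umx s gamma (x t)) *m
           (gradient f (x t) + A^T *m y t +
            sigma1 *: (A^T *m (A *m x t - b))))),
      x t0 = x0,
      is_derivative_from t0 y (fun t => sigma2 *: (A *m x t - b))
    & y t0 = y0].

Definition limit_set (R : realType) (m n : nat)
    (x : R -> 'cV[R]_n) (y : R -> 'cV[R]_m) : set ('cV[R]_n * 'cV[R]_m) :=
  [set p | exists2 t_ : nat -> R, t_ @ \oo --> +oo &
     (fun k => (x (t_ k), y (t_ k))) @ \oo --> p].

(* Main.v *)
(* Let [a] be optimal and [ya] a Lagrange multiplier for [A x = b] at [a]
   (Farkas). The Lyapunov function
     [V = sum_i phi_i(x_i) + |y - ya|^2 / (2 sigma2)],
     [phi_i'(v) = (v - a_i) / u_i(v)^2],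
   is bounded below, and the factor [U(x)^2] of the ODE cancels in its
   derivative, which is [- W(x)] with
     [W(x) = (x - a).(grad f(x) + A^T ya) + sigma1 |A x - b|^2 >= 0]
   by convexity. If [W(p1) > 0] at a limit point [(p1, p2)], then [W] is bounded
   away from [0] and the speed is bounded near [(p1, p2)], so each of the
   infinitely many visits of the trajectory near [(p1, p2)] lasts a definite
   time and decreases [V] by a definite amount: a contradiction. Hence
   [W(p1) = 0], which gives [A p1 = b] and [(p1 - a).grad f(p1) = 0], and
   convexity yields [f p1 <= f a]. *)
Require Import Defs.
From mathcomp Require Import all_boot all_order all_algebra.
From mathcomp Require Import all_classical all_reals all_analysis.
From mathcomp Require Import ring lra.
Import Order.TTheory GRing.Theory Num.Theory.
Import numFieldNormedType.Exports.

Local Open Scope classical_set_scope.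
Local Open Scope ring_scope.

(** * Farkas' lemma *)

(* Bartl's induction on the number of rows: if [c] is not already nonnegative
   on the cone of the last rows, some [x1] in that cone has [a x1 = -1] and
   [c x1 < 0], and one projects along [x1] onto the kernel of the first row
   [a]. *)
Lemma farkas (R : realFieldType) (k n : nat) (M : 'M[R]_(k, n)) (c : 'rV[R]_n) :
  (forall d : 'cV_n, (forall i, 0 <= (M *m d) i 0) -> 0 <= (c *m d) 0 0) ->
  exists2 u : 'rV_k, (forall i, 0 <= u 0 i) & c = u *m M.
Proof.
elim: k M c => [|k IHk]; last rewrite -[k.+1]/(1 + k)%N; move=> M c cP.
  exists 0 => [i|]; first by rewrite mxE.
  rewrite mul0mx; apply/rowP => j; rewrite mxE; apply/eqP.
  (* With no rows the hypothesis constrains every [d], and testing it on both signs of each basis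
     vector forces [c = 0]. *)
  have E d : (c *m (d *: delta_mx j 0 : 'cV_n)) 0 0 = d * c 0 j.
    by rewrite -scalemxAr -colE !mxE.
  have c_ge d : 0 <= d * c 0 j by rewrite -E; apply: cP => -[].
  have := c_ge 1; have := c_ge (-1); rewrite mulN1r mul1r oppr_ge0 => ? ?.
  by apply/eqP/le_anti/andP.
pose a : 'rV_n := usubmx M.
pose N : 'M[R]_(k, n) := dsubmx M.
have defM : M = col_mx a N by rewrite vsubmxK.
have MP (d : 'cV_n) : 0 <= (a *m d) 0 0 -> (forall i, 0 <= (N *m d) i 0) ->
    forall i, 0 <= (M *m d) i 0.
  move=> ad Nd i; rewrite defM mul_col_mx -(splitK i).
  by case: (fintype.split i) => j; rewrite ?col_mxEu ?col_mxEd ?ord1.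
have [cN|/existsNP[x0 /not_implyP[Nx0 /negP]]] :=
    pselect (forall d : 'cV_n, (forall i, 0 <= (N *m d) i 0) -> 0 <= (c *m d) 0 0).
  have [u u_ge0 ->] := IHk N c cN.
  exists (row_mx 0 u) => [i|]; last first.
    by rewrite defM mul_row_col mul0mx add0r.
  rewrite -(splitK i); case: (fintype.split i) => j.
    by rewrite row_mxEl mxE.
  by rewrite row_mxEr.
rewrite -ltNge => cx0.
have ax0 : (a *m x0) 0 0 < 0.
  rewrite ltNge; apply/negP => ax0.
  by move: cx0; rewrite ltNge cP//; exact: MP.
pose x1 := (- (a *m x0) 0 0)^-1 *: x0.
have t_gt0 : 0 < (- (a *m x0) 0 0)^-1 by rewrite invr_gt0 oppr_gt0.
have ax1 : a *m x1 = - 1%:M.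
  apply/matrixP => i j; rewrite !ord1 /x1 -scalemxAr [LHS]mxE [RHS]mxE.
  by rewrite [1%:M _ _]mxE eqxx mulr1n invrN mulNr mulVf// lt_eqF.
have Nx1 i : 0 <= (N *m x1) i 0.
  by rewrite /x1 -scalemxAr mxE mulr_ge0// ltW.
have cx1 : (c *m x1) 0 0 < 0.
  by rewrite /x1 -scalemxAr mxE pmulr_rlt0.
have [d|u u_ge0 cE] := IHk (N + (N *m x1) *m a) (c + (c *m x1) *m a).
  set y := d + x1 *m (a *m d).
  have -> : (N + (N *m x1) *m a) *m d = N *m y.
    by rewrite mulmxDl mulmxDr !mulmxA.
  have -> : (c + (c *m x1) *m a) *m d = c *m y.
    by rewrite mulmxDl mulmxDr !mulmxA.
  move=> Ny; apply/cP/MP => //.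
  by rewrite mulmxDr [a *m (_ *m _)]mulmxA ax1 mulNmx mul1mx subrr mxE.
(* Undoing the projection moves all multiples of [a] into one coefficient, nonnegative because
   [N *m x1 >= 0] and [c *m x1 < 0]. *)
have {}cE : c = (u *m (N *m x1) - c *m x1) *m a + u *m N.
  rewrite -[LHS](addrK (c *m x1 *m a)) cE mulmxBl mulmxDr !mulmxA.
  by rewrite [RHS]addrAC [X in _ = X - _]addrC.
exists (row_mx (u *m (N *m x1) - c *m x1) u) => [i|]; last first.
  by rewrite defM mul_row_col.
rewrite -(splitK i); case: (fintype.split i) => j; last by rewrite row_mxEr.
rewrite row_mxEl ord1 !mxE subr_ge0; apply: (le_trans (y := 0)).
  by move: cx1; rewrite mxE => /ltW.
by apply: sumr_ge0 => l _; rewrite mulr_ge0.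
Qed.

(** * Descent along a trajectory *)

Lemma MVT_is_derive (R : realType) (f df : R -> R) (a b : R) : a < b ->
  (forall t, a <= t <= b -> is_derive t 1 f (df t)) ->
  exists2 c, a < c < b & f b - f a = df c * (b - a).
Proof.
move=> ab fdf.
have [||c cab E] := @MVT R f df a b ab.
- by move=> t /[!in_itv]/= /andP[at_ tb]; apply: fdf; rewrite !ltW.
- apply: derivable_within_continuous => t; rewrite in_itv/= => tab.
  by case: (fdf t tab).
- by exists c => //; move: cab; rewrite in_itv.
Qed.

(** Here [V] is a Lyapunov function and [q] a distance to a limit point. Once [V] is close to its
    infimum, a visit to [q < delta / 2] would keep [q < delta] long enough for [V] to drop below
    that infimum. *)
Lemma descent_leaves_sublevel (R : realType) (t0 delta c M B : R)
    (V dV q dq : R -> R) :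
  0 < delta -> 0 < c -> 0 < M ->
  (forall t, t0 < t -> is_derive t 1 V (dV t)) ->
  (forall t, t0 < t -> is_derive t 1 q (dq t)) ->
  (forall t, t0 < t -> dV t <= 0) ->
  (forall t, t0 < t -> B <= V t) ->
  (forall t, t0 < t -> q t < delta -> dV t <= - c) ->
  (forall t, t0 < t -> q t < delta -> dq t <= M) ->
  exists2 T, t0 < T & forall t, T <= t -> delta / 2 <= q t.
Proof.
move=> d_gt0 c_gt0 M_gt0 Vder qder dV_le0 V_ge dV_le dq_le.
(* At speed at most [M], climbing from [delta / 2] to [delta] takes at least [tau]. *)
pose tau := delta / 2 / M.
have tau_gt0 : 0 < tau by rewrite !divr_gt0.
pose E := V @` [set t | t0 < t].
have EL : has_lbound E by exists B => _ [t t0t <-]; exact: V_ge.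
have E0 : E !=set0 by exists (V (t0 + 1)), (t0 + 1) => //=; rewrite ltrDl.
(* From [T] on, [V] exceeds its infimum by less than [c * tau], the drop caused by one visit. *)
have [_ [T /= t0T <-] VT] := inf_adherent (mulr_gt0 c_gt0 tau_gt0) (conj E0 EL).
exists T => // t Tt; rewrite leNgt; apply/negP => qt.
have t0t := lt_le_trans t0T Tt.
have VtT : V t <= V T.
  move: Tt; rewrite le_eqVlt => /predU1P[->//|Tt].
  have [|u /andP[Tu ut] VE] := MVT_is_derive _ V dV _ _ Tt.
    by move=> u /andP[Tu _]; apply/Vder/(lt_le_trans t0T).
  rewrite -subr_le0 VE mulr_le0_ge0 ?subr_ge0 ?(ltW Tt)//.
  exact/dV_le0/(lt_trans t0T).
have q_lt u : t <= u <= t + tau -> q u < delta.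
  move=> /andP[tu ut]; rewrite ltNge; apply/negP => qu.
  (* [e] is the first exit time from the sublevel set. *)
  pose S := [set r | t <= r /\ delta <= q r].
  have SL : lbound S t by move=> r [].
  have SL' : has_lbound S by exists t.
  have S0 : S !=set0 by exists u.
  pose e := inf S.
  have te : t <= e by exact: lb_le_inf.
  have eu : e <= u by exact: ge_inf.
  (* The infimum is attained: otherwise continuity keeps [q < delta] just after [e], where elements
     of [S] must lie. *)
  have qe : delta <= q e.
    rewrite leNgt; apply/negP => qe.
    have qc : {for e, continuous q}.
      apply/differentiable_continuous/derivable1_diffP/ex_derive.
      exact/qder/(lt_le_trans t0t).
    have : \forall r \near e, q r < delta by exact: (cvgr_lt (q e) qc).
    move=> /nbhs_ballP[r /= r0 qr].
    have [v [tv qv] ve] := inf_adherent r0 (conj S0 SL').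
    have: q v < delta.
      apply: qr; rewrite /ball/= distrC ltr_norml.
      have : e <= v by exact: ge_inf.
      by rewrite -/e in ve; lra.
    by rewrite ltNge qv.
  have {}te : t < e.
    by rewrite lt_neqAle te andbT; apply/eqP => te'; rewrite -te' in qe; lra.
  have [|r /andP[tr re] qE] := MVT_is_derive _ q dq _ _ te.
    by move=> r /andP[tr _]; apply/qder/(lt_le_trans t0t).
  have qr : q r < delta.
    rewrite ltNge; apply/negP => qr.
    suff : e <= r by rewrite leNgt re.
    by apply: ge_inf => //; split => //; exact: ltW.
  have dqM := dq_le r (lt_trans t0t tr) qr.
  have : q e - q t <= M * tau.
    rewrite qE; apply: (le_trans (y := M * (e - t))).
      by rewrite ler_wpM2r// subr_ge0 ltW.
    by rewrite ler_pM2l//; lra.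
  by rewrite /tau mulrCA divff ?gt_eqF// mulr1; lra.
have ttau : t < t + tau by rewrite ltrDl.
have [|u /andP[tu ut] VE] := MVT_is_derive _ V dV _ _ ttau.
  by move=> u /andP[tu _]; apply/Vder/(lt_le_trans t0t).
have : V (t + tau) - V t <= - c * tau.
  rewrite VE [t + tau]addrC addrK ler_pM2r// dV_le//.
    exact: lt_trans tu.
  by rewrite q_lt// !ltW.
have : inf E <= V (t + tau).
  by apply: ge_inf => //; exists (t + tau) => //=; exact: lt_trans ttau.
lra.
Qed.

(** * Convexity and first-order optimality *)

Lemma derive_at_right (R : realType) (V W : normedModType R) (f : V -> W)
    (x v : V) : derivable f x v ->
  h^-1 *: (f (h *: v + x) - f x) @[h --> 0^'+] --> 'D_v f x.
Proof. by move=> fx; apply: cvg_dnbhs_at_right; exact: fx. Qed.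

(** Convexity bounds each difference quotient with [0 < h <= 1] by [f z - f x]; then [h] tends to 0
    from the right. *)
Lemma convex_gradient_le (R : realType) (V : normedModType R) (f : V -> R)
    (x z : V) : convex_function [set: V] f -> differentiable f x ->
  f x + 'D_(z - x) f x <= f z.
Proof.
move=> fconv fx; rewrite addrC -lerBrDr.
have fr := derive_at_right _ _ _ _ _ (z - x) (diff_derivable fx).
rewrite -(cvg_lim _ fr)//; apply: limr_le; first by apply/cvg_ex; eexists; exact: fr.
near=> h.
have h_gt0 : 0 < h by near: h; exact: nbhs_right_gt.
have h_le1 : h <= 1 by near: h; exact: nbhs_right_le.
have := fconv (Itv01 (ltW h_gt0) h_le1) z x (in_setT _) (in_setT _).
rewrite convRE /=.
rewrite -[conv _ _ _]/(h *: z + (1 - h) *: x) /unstable.onem.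
have -> : h *: z + (1 - h) *: x = h *: (z - x) + x.
  by rewrite scalerBr scalerBl scale1r [x - _]addrC addrA.
move=> fle; rewrite -[_ *: _]/(_ * _) mulrC ler_pdivrMr//.
lra.
Unshelve. all: by end_near. Qed.

Lemma gradient_dot (R : realType) (n : nat) (f : 'cV[R]_n -> R)
    (x v : 'cV[R]_n) : differentiable f x ->
  'D_v f x = \sum_i v i 0 * gradient f x i 0.
Proof.
move=> fx; rewrite deriveE// {1}[v]matrix_sum_delta linear_sum.
apply: eq_bigr => i _; rewrite big_ord1 linearZ/= mxE deriveE//.
Qed.

(** Short steps along [d] stay feasible: active sign constraints are protected by the hypothesis on
    [d], inactive ones have slack. Hence the right difference quotients are nonnegative. *)
Lemma optimal_directional_derivative (R : realType) (m n : nat)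
    (f : 'cV[R]_n -> R) (A : 'M[R]_(m, n)) (b : 'cV[R]_m) (s : nat)
    (a d : 'cV[R]_n) :
  optimal_solution f A b s a -> derivable f a d -> A *m d = 0 ->
  (forall i : 'I_n, (i < s)%N -> a i 0 = 0 -> 0 <= d i 0) ->
  0 <= 'D_d f a.
Proof.
move=> [[Aa a_ge0] a_min] fa Ad d_ge0.
have fr := derive_at_right _ _ _ _ _ _ fa.
rewrite -(cvg_lim _ fr)//; apply: limr_ge; first by apply/cvg_ex; eexists; exact: fr.
have d_feas : \forall h \near 0^'+, forall i : 'I_n, (i < s)%N -> 0 <= h * d i 0 + a i 0.
  apply: filter_forall => i.
  have [is_|_] := boolP (i < s)%N; last by apply: nearW.
  have [ai0|ai_neq0] := eqVneq (a i 0) 0.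
    near=> h; move=> _; rewrite ai0 addr0 mulr_ge0 ?d_ge0//.
  have ai_gt0 : 0 < a i 0 by rewrite lt_neqAle eq_sym ai_neq0 a_ge0.
  have di_gt0 : 0 < `|d i 0| + 1 by rewrite ltr_wpDl.
  near=> h; move=> _.
  have h_gt0 : 0 < h by near: h; exact: nbhs_right_gt.
  (* This bound gives [h * |d_i| <= a_i]; the [+ 1] avoids a zero denominator. *)
  have : h <= a i 0 / (`|d i 0| + 1).
    by near: h; apply: nbhs_right_le; rewrite divr_gt0.
  rewrite ler_pdivlMr// mulrDr mulr1 => hd.
  have : - `|h * d i 0| <= h * d i 0 by rewrite lerNnormlW.
  rewrite normrM (gtr0_norm h_gt0); lra.
near=> h.
have h_gt0 : 0 < h by near: h; exact: nbhs_right_gt.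
rewrite -[_ *: _]/(_ * _) mulr_ge0 ?invr_ge0 ?(ltW h_gt0)// subr_ge0 a_min//.
split; first by rewrite mulmxDr -scalemxAr Ad scaler0 add0r.
have hP : forall i : 'I_n, (i < s)%N -> 0 <= h * d i 0 + a i 0 by near: h.
by move=> i /hP; rewrite !mxE.
Unshelve. all: by end_near. Qed.

(** By Farkas on the linearised constraints, [gradient f a + A^T *m y] is nonnegative and supported
    on the active coordinates, where [x i 0 - a i 0] reduces to [x i 0]. *)
Lemma kkt_multiplier (R : realType) (m n : nat) (f : 'cV[R]_n -> R)
    (A : 'M[R]_(m, n)) (b : 'cV[R]_m) (s : nat) (a : 'cV[R]_n) :
  optimal_solution f A b s a -> differentiable f a ->
  exists y : 'cV[R]_m, forall x : 'cV[R]_n,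
    (forall i : 'I_n, (i < s)%N -> 0 <= x i 0) ->
    0 <= \sum_i (x i 0 - a i 0) * (gradient f a + A^T *m y) i 0.
Proof.
move=> aopt fa; have [_ a_ge0] := aopt.1.
pose J (i : 'I_n) := ((i < s)%N && (a i 0 == 0)).
(* Inactive coordinates give zero rows of [D], hence no condition on [d]. The pair [A], [- A]
   encodes the equality [A *m d = 0]. *)
pose D : 'M[R]_n := diag_mx (\row_i (J i)%:R).
have [d dP|u u_ge0] := farkas _ _ _ (col_mx A (col_mx (- A) D)) (gradient f a)^T.
  have -> : ((gradient f a)^T *m d) 0 0 = 'D_d f a.
    by rewrite gradient_dot// mxE; apply: eq_bigr => i _; rewrite !mxE mulrC.
  have Ad_ge0 i : 0 <= (A *m d) i 0.
    by have := dP (lshift _ i); rewrite mul_col_mx col_mxEu.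
  have Ad_le0 i : 0 <= - (A *m d) i 0.
    have := dP (rshift _ (lshift _ i)).
    by rewrite mul_col_mx col_mxEd mul_col_mx col_mxEu mulNmx mxE.
  apply: (optimal_directional_derivative _ _ _ _ _ _ _ _ _ aopt).
  - exact: diff_derivable.
  - apply/colP => i; rewrite [RHS]mxE; apply/eqP.
    by rewrite eq_le Ad_ge0 andbT -oppr_ge0.
  - move=> i is_ ai0; have := dP (rshift _ (rshift _ i)).
    rewrite mul_col_mx col_mxEd mul_col_mx col_mxEd mul_diag_mx !mxE.
    by rewrite /J is_ ai0 eqxx mul1r.
rewrite -[u]hsubmxK -[rsubmx u]hsubmxK !mul_row_col.
set u1 := lsubmx u; set u2 := lsubmx _; set u3 := rsubmx _ => gE.
exists (u2 - u1)^T => x x_ge0; apply: sumr_ge0 => i _.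
have -> : gradient f a + A^T *m (u2 - u1)^T = (u3 *m D)^T.
  rewrite -[gradient f a]trmxK gE -!trmx_mul -linearD/=; congr (_^T).
  by rewrite mulmxBl mulmxN addrC addrA subrK addrA subrr add0r.
rewrite mxE mul_mx_diag !mxE /J.
have [/andP[is_ /eqP ->]|_] := boolP (_ && _); last by rewrite !mulr0.
by rewrite subr0 mulr1 mulr_ge0 ?x_ge0// /u3 !mxE.
Qed.

(** * Scalar potentials of the Lyapunov function *)

(* Primitives of [(x - a) / x^(2 gamma)]; the case [gamma = 1/2], where the
   primitive of [x^(- 2 gamma)] is the logarithm, has to be separated. *)
Lemma powR_lyapunov (R : realType) (gamma a : R) :
  2^-1 <= gamma < 1 -> 0 <= a ->
  exists (phi : R -> R) (B : R), forall x : R, 0 < x ->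
    B <= phi x /\ is_derive x 1 phi ((x - a) / (x `^ gamma * x `^ gamma)).
Proof.
move=> /andP[g_ge g_lt1] a_ge0.
have [gE|g_neq] := eqVneq gamma 2^-1.
  (* The lower bound is the value at the minimiser [x = a]; for [a = 0] the factor [a] kills the
     logarithm and the bound is 0. *)
  exists (fun x => x - a * ln x), (a - a * ln a) => x x_gt0.
  have xE : x `^ gamma * x `^ gamma = x.
    rewrite -powRD; last by rewrite (gt_eqF x_gt0) implybT.
    by rewrite gE -mulr2n -[_ *+ 2]mulr_natl divff// powRr1// ltW.
  split.
    have [->|a_neq0] := eqVneq a 0; first by rewrite !mul0r !subr0 ltW.
    have a_gt0 : 0 < a by rewrite lt_neqAle eq_sym a_neq0.
    have : ln (1 + (x / a - 1)) <= x / a - 1.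
      by apply: le_ln1Dx; have := divr_gt0 x_gt0 a_gt0; lra.
    rewrite addrC subrK lnM ?posrE ?invr_gt0// lnV ?posrE// => h.
    have : a * (ln x - ln a) <= a * (x / a - 1) by rewrite ler_pM2l.
    rewrite mulrBr mulrBr mulrCA divff// !mulr1; lra.
  rewrite xE.
  have := is_derive1_ln x_gt0 => lnx.
  apply: is_derive_eq.
  by rewrite -[_ *: _]/(_ * _); field; rewrite gt_eqF.
have g_gt : 2^-1 < gamma by rewrite lt_neqAle eq_sym g_neq.
pose p := 2 - 2 * gamma; pose r := 2 * gamma - 1.
have p_gt0 : 0 < p by rewrite /p; lra.
have r_gt0 : 0 < r by rewrite /r; lra.
(* Since [1/2 < gamma < 1], both [p] and [r] are positive, so both terms are nonnegative and 0 is a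
   lower bound. *)
exists (fun x => p^-1 * x `^ p + a / r * x `^ (- r)), 0 => x x_gt0; split.
  by rewrite addr_ge0 ?mulr_ge0 ?powR_ge0 ?invr_ge0 ?(ltW p_gt0) ?(ltW r_gt0).
have xd := is_derive1_powR p x_gt0.
have xd' := is_derive1_powR (- r) x_gt0.
have xD (u v : R) : x `^ (u + v) = x `^ u * x `^ v.
  by rewrite powRD// (gt_eqF x_gt0) implybT.
apply: is_derive_eq.
have -> : - r - 1 = - gamma + - gamma by rewrite /r; ring.
have -> : p - 1 = 1 + (- gamma + - gamma) by rewrite /p; ring.
rewrite !xD powRr1 ?(ltW x_gt0)// powRN -![_ *: _]/(_ * _).
by field; rewrite !gt_eqF ?powR_gt0.
Qed.

(** * The dissipation and its zeros *)

Lemma mulmx_trmx_dot (R : realType) (m n : nat) (A : 'M[R]_(m, n))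
    (v : 'cV[R]_n) (y : 'cV[R]_m) :
  \sum_i v i 0 * (A^T *m y) i 0 = \sum_j (A *m v) j 0 * y j 0.
Proof.
have -> : \sum_i v i 0 * (A^T *m y) i 0 = (v^T *m (A^T *m y)) 0 0.
  by rewrite mxE; apply: eq_bigr => i _; rewrite [v^T _ _]mxE.
by rewrite mulmxA -trmx_mul mxE; apply: eq_bigr => j _; rewrite [_^T _ _]mxE.
Qed.

(* Minus the time derivative of the Lyapunov function, see
   [lyapunov_derivative]. *)
Definition dissipation (R : realType) (m n : nat) (f : 'cV[R]_n -> R)
    (A : 'M[R]_(m, n)) (b : 'cV[R]_m) (sigma : R) (a : 'cV[R]_n)
    (y : 'cV[R]_m) (x : 'cV[R]_n) : R :=
  \sum_i (x i 0 - a i 0) * (gradient f x + A^T *m y) i 0 +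
  sigma * \sum_j (A *m x - b) j 0 ^+ 2.

Arguments dissipation {R m n}.

(** Sum of the two first-order convexity inequalities, at [x] towards [z] and at [z] towards [x]. *)
Lemma gradient_monotone (R : realType) (n : nat) (f : 'cV[R]_n -> R)
    (x z : 'cV[R]_n) : convex_function [set: 'cV[R]_n] f ->
  (forall x, differentiable f x) ->
  0 <= \sum_i (x i 0 - z i 0) * (gradient f x i 0 - gradient f z i 0).
Proof.
move=> fconv fd.
have xz := convex_gradient_le _ _ _ x z fconv (fd x).
have zx := convex_gradient_le _ _ _ z x fconv (fd z).
rewrite gradient_dot// in xz; rewrite gradient_dot// in zx.
have -> : \sum_i (x i 0 - z i 0) * (gradient f x i 0 - gradient f z i 0) =
    - \sum_i (z - x) i 0 * gradient f x i 0 - \sum_i (x - z) i 0 * gradient f z i 0.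
  rewrite -sumrN -sumrB; apply: eq_bigr => i _.
  by rewrite [(z - x) _ _]mxE [(x - z) _ _]mxE [(- x) _ _]mxE [(- z) _ _]mxE; ring.
lra.
Qed.

(** Isolates three terms nonnegative for separate reasons: monotonicity of the gradient, the
    multiplier inequality at [a], and a sum of squares. *)
Lemma dissipation_split (R : realType) (m n : nat) (f : 'cV[R]_n -> R)
    (A : 'M[R]_(m, n)) (b : 'cV[R]_m) (sigma : R) (a : 'cV[R]_n)
    (y : 'cV[R]_m) (x : 'cV[R]_n) :
  dissipation f A b sigma a y x =
  \sum_i (x i 0 - a i 0) * (gradient f x i 0 - gradient f a i 0) +
  \sum_i (x i 0 - a i 0) * (gradient f a + A^T *m y) i 0 +
  sigma * \sum_j (A *m x - b) j 0 ^+ 2.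
Proof.
rewrite /dissipation -big_split; congr (_ + _); apply: eq_bigr => i _ /=.
rewrite [(gradient f x + _) _ _]mxE [(gradient f a + _) _ _]mxE; ring.
Qed.

Lemma dissipation_ge0 (R : realType) (m n : nat) (f : 'cV[R]_n -> R)
    (A : 'M[R]_(m, n)) (b : 'cV[R]_m) (sigma : R) (a : 'cV[R]_n)
    (y : 'cV[R]_m) (x : 'cV[R]_n) :
  convex_function [set: 'cV[R]_n] f -> (forall x, differentiable f x) ->
  0 <= sigma ->
  0 <= \sum_i (x i 0 - a i 0) * (gradient f a + A^T *m y) i 0 ->
  0 <= dissipation f A b sigma a y x.
Proof.
move=> fconv fd sigma_ge0 kkt; rewrite dissipation_split.
rewrite !addr_ge0 ?gradient_monotone// mulr_ge0// sumr_ge0// => j _.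
exact: sqr_ge0.
Qed.

(** All three terms of [dissipation_split] vanish, so [A *m x = b]. Then [x - a] lies in the kernel
    of [A], the multiplier drops out, and the gradient inequality at [x] gives [f x <= f a]. *)
Lemma dissipation_eq0_optimal (R : realType) (m n : nat) (f : 'cV[R]_n -> R)
    (A : 'M[R]_(m, n)) (b : 'cV[R]_m) (s : nat) (sigma : R) (a : 'cV[R]_n)
    (y : 'cV[R]_m) (x : 'cV[R]_n) :
  convex_function [set: 'cV[R]_n] f -> (forall x, differentiable f x) ->
  0 < sigma -> optimal_solution f A b s a ->
  0 <= \sum_i (x i 0 - a i 0) * (gradient f a + A^T *m y) i 0 ->
  (forall i : 'I_n, (i < s)%N -> 0 <= x i 0) ->
  dissipation f A b sigma a y x = 0 -> optimal_solution f A b s x.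
Proof.
move=> fconv fd sigma_gt0 [[Aa _] a_min] kkt x_ge0 W0.
have r_ge0 : 0 <= \sum_j (A *m x - b) j 0 ^+ 2.
  by apply: sumr_ge0 => j _; exact: sqr_ge0.
have r0 : \sum_j (A *m x - b) j 0 ^+ 2 = 0.
  apply/eqP; rewrite eq_le r_ge0 andbT -(pmulr_rle0 _ sigma_gt0).
  have := gradient_monotone _ _ _ x a fconv fd.
  by have := dissipation_split _ _ _ f A b sigma a y x; rewrite W0; lra.
have Ax : A *m x = b.
  apply/eqP; rewrite -subr_eq0; apply/eqP/colP => j; rewrite [RHS]mxE.
  apply/eqP; rewrite -sqrf_eq0; apply/eqP.
  by apply: (psumr_eq0P _ r0) => // i _; exact: sqr_ge0.
split=> [//|z zfeas]; apply: le_trans (a_min z zfeas).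
have := convex_gradient_le _ _ _ x a fconv (fd x).
rewrite gradient_dot//.
suff -> : \sum_i (a - x) i 0 * gradient f x i 0 = 0 by rewrite addr0.
have Aax : A *m (a - x) = 0 by rewrite mulmxBr Aa Ax subrr.
have yA0 : \sum_i (a - x) i 0 * (A^T *m y) i 0 = 0.
  by rewrite mulmx_trmx_dot Aax big1// => j _; rewrite mxE mul0r.
move: W0; rewrite /dissipation r0 mulr0 addr0 => W0.
apply/eqP; rewrite -[X in X == _]addr0 -[X in _ + X]yA0 -big_split/=.
rewrite -oppr_eq0 -sumrN; apply/eqP; rewrite -[RHS]W0; apply: eq_bigr => i _.
by rewrite [(gradient f x + _) _ _]mxE [(a - x) _ _]mxE [(- x) _ _]mxE; ring.
Qed.

(** * Coordinatewise derivatives and limits *)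

Lemma is_derive_coord (R : realType) (m n : nat) (x : R -> 'M[R]_(m, n))
    (t : R) (dx : 'M[R]_(m, n)) (i : 'I_m) (j : 'I_n) :
  is_derive t 1 x dx -> is_derive t 1 (fun t => x t i j) (dx i j).
Proof.
move=> [xd <-]; apply: DeriveDef; first by move/derivable_mxP: xd.
by rewrite derive_mx// mxE.
Qed.

Lemma cvg_sum (R : realType) (I : finType) (T : Type) (F : set_system T)
    (h : I -> T -> R) (l : I -> R) : Filter F ->
  (forall i, h i z @[z --> F] --> l i) ->
  \sum_i h i z @[z --> F] --> \sum_i l i.
Proof. by move=> FF hl; apply: cvg_big => //; exact: add_continuous. Qed.

Lemma cvg_mulmx_coord (R : realType) (m n : nat) (T : Type) (F : set_system T)
    (A : 'M[R]_(m, n)) (h : T -> 'cV[R]_n) (l : 'cV[R]_n) (i : 'I_m) :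
  Filter F -> (forall j, h z j 0 @[z --> F] --> l j 0) ->
  (A *m h z) i 0 @[z --> F] --> (A *m l) i 0.
Proof.
move=> FF hl; rewrite mxE; under eq_fun do rewrite mxE.
by apply: cvg_sum => j; apply: cvgM => //; exact: cvg_cst.
Qed.

Lemma Umx_mulmxE (R : realType) (n s : nat) (gamma : R) (x g : 'cV[R]_n)
    (i : 'I_n) (u := if (i < s)%N then x i 0 `^ gamma else 1) :
  (Umx s gamma x *m Umx s gamma x *m g) i 0 = u * u * g i 0.
Proof. by rewrite -mulmxA /Umx !mul_diag_mx !mxE mulrA. Qed.

Lemma is_derive_sumE (R : realType) (n : nat) (h : 'I_n -> R -> R)
    (dh : 'I_n -> R) (t : R) : (forall i, is_derive t 1 (h i) (dh i)) ->
  is_derive t 1 (fun r => \sum_i h i r) (\sum_i dh i).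
Proof. by move=> hd; rewrite -fct_sumE; exact: is_derive_sum. Qed.

Lemma is_derive_sqr_subr (R : realType) (h : R -> R) (dh c t : R) :
  is_derive t 1 h dh ->
  is_derive t 1 (fun r => (h r - c) ^+ 2) (2 * (h t - c) * dh).
Proof.
move=> hd; apply: is_derive_eq.
rewrite -![_ *: _]/(_ * _) /=; ring.
Qed.

(** The [x]-gradient of the augmented Lagrangian [f(x) + y.(A x - b) + (sigma / 2) |A x - b|^2]. *)
Definition field_direction (R : realType) (m n : nat) (f : 'cV[R]_n -> R)
    (A : 'M[R]_(m, n)) (b : 'cV[R]_m) (sigma : R) (x : 'cV[R]_n)
    (y : 'cV[R]_m) : 'cV[R]_n :=
  gradient f x + A^T *m y + sigma *: (A^T *m (A *m x - b)).

Arguments field_direction {R m n}.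

(** Trading [y] for the fixed [ya] leaves a cross term, since [A *m (x - a) = A *m x - b]; the
    [y]-part of the Lyapunov derivative cancels it. *)
Lemma field_direction_dot (R : realType) (m n : nat) (f : 'cV[R]_n -> R)
    (A : 'M[R]_(m, n)) (b : 'cV[R]_m) (sigma : R) (a x : 'cV[R]_n)
    (ya y : 'cV[R]_m) : A *m a = b ->
  \sum_i (x i 0 - a i 0) * field_direction f A b sigma x y i 0 =
  dissipation f A b sigma a ya x +
  \sum_j (y j 0 - ya j 0) * (A *m x - b) j 0.
Proof.
move=> Aa; rewrite /dissipation.
have xaE i : x i 0 - a i 0 = (x - a) i 0 by rewrite !mxE.
have rE : A *m x - b = A *m (x - a) by rewrite mulmxBr Aa.
have -> : \sum_j (y j 0 - ya j 0) * (A *m x - b) j 0 =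
    \sum_i (x - a) i 0 * (A^T *m (y - ya)) i 0.
  rewrite mulmx_trmx_dot -rE; apply: eq_bigr => j _.
  by rewrite [(y - ya) _ _]mxE [(- ya) _ _]mxE mulrC.
have -> : \sum_j (A *m x - b) j 0 ^+ 2 =
    \sum_i (x - a) i 0 * (A^T *m (A *m x - b)) i 0.
  by rewrite mulmx_trmx_dot -rE; apply: eq_bigr => j _; rewrite expr2.
rewrite mulr_sumr -!big_split/=; apply: eq_bigr => i _.
rewrite /field_direction [A^T *m (y - ya)]mulmxBr.
move: (gradient f x) (A^T *m (A *m x - b)) (A^T *m y) (A^T *m ya) => g u v w.
rewrite !mxE; ring.
Qed.

Lemma cvg_coord (R : realType) (n : nat) (T : Type) (F : set_system T)
    (X : T -> 'cV[R]_n) (p : 'cV[R]_n) (i : 'I_n) : Filter F ->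
  X z @[z --> F] --> p -> X z i 0 @[z --> F] --> p i 0.
Proof.
move=> FF Xp; apply: (cvg_comp X (fun u : 'cV[R]_n => u i 0) (G := nbhs p)) => //.
exact: coord_continuous.
Qed.

Lemma cvg_gradient_coord (R : realType) (n : nat) (f : 'cV[R]_n -> R)
    (T : Type) (F : set_system T) (X : T -> 'cV[R]_n) (p : 'cV[R]_n)
    (i : 'I_n) : Filter F -> differentiable (gradient f) p ->
  X z @[z --> F] --> p -> gradient f (X z) i 0 @[z --> F] --> gradient f p i 0.
Proof.
move=> FF gd Xp; apply: cvg_coord.
apply: (cvg_comp X (gradient f) (G := nbhs p)) => //.
exact: (differentiable_continuous gd).
Qed.

Lemma cvg_residual_coord (R : realType) (m n : nat) (A : 'M[R]_(m, n))
    (b : 'cV[R]_m) (T : Type) (F : set_system T) (X : T -> 'cV[R]_n)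
    (p : 'cV[R]_n) (j : 'I_m) : Filter F -> X z @[z --> F] --> p ->
  (A *m X z - b) j 0 @[z --> F] --> (A *m p - b) j 0.
Proof.
move=> FF Xp; rewrite mxE; under eq_fun do rewrite mxE.
apply: cvgD; last exact: cvg_cst.
by apply: cvg_mulmx_coord => i; exact: cvg_coord.
Qed.

Lemma cvg_field_direction_coord (R : realType) (m n : nat)
    (f : 'cV[R]_n -> R) (A : 'M[R]_(m, n)) (b : 'cV[R]_m) (sigma : R)
    (T : Type) (F : set_system T) (X : T -> 'cV[R]_n) (Y : T -> 'cV[R]_m)
    (p : 'cV[R]_n) (q : 'cV[R]_m) (i : 'I_n) :
  Filter F -> differentiable (gradient f) p ->
  X z @[z --> F] --> p -> Y z @[z --> F] --> q ->
  field_direction f A b sigma (X z) (Y z) i 0 @[z --> F] -->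
  field_direction f A b sigma p q i 0.
Proof.
move=> FF gd Xp Yq.
have E x y : field_direction f A b sigma x y i 0 =
    gradient f x i 0 + (A^T *m y) i 0 + sigma * (A^T *m (A *m x - b)) i 0.
  rewrite /field_direction.
  by move: (gradient f x) (A^T *m y) (A^T *m (A *m x - b)) => g u v; rewrite !mxE.
rewrite E; under eq_fun do rewrite E.
apply: cvgD; first apply: cvgD.
- exact: cvg_gradient_coord.
- by apply: cvg_mulmx_coord => j; exact: cvg_coord.
- apply: cvgM; first exact: cvg_cst.
  by apply: cvg_mulmx_coord => j; exact: cvg_residual_coord.
Qed.

Lemma cvg_dissipation (R : realType) (m n : nat) (f : 'cV[R]_n -> R)
    (A : 'M[R]_(m, n)) (b : 'cV[R]_m) (sigma : R) (a : 'cV[R]_n)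
    (y : 'cV[R]_m) (T : Type) (F : set_system T) (X : T -> 'cV[R]_n)
    (p : 'cV[R]_n) :
  Filter F -> differentiable (gradient f) p -> X z @[z --> F] --> p ->
  dissipation f A b sigma a y (X z) @[z --> F] -->
  dissipation f A b sigma a y p.
Proof.
move=> FF gd Xp; rewrite /dissipation; apply: cvgD.
  apply: cvg_sum => i; apply: cvgM.
    by apply: cvgB; [exact: cvg_coord|exact: cvg_cst].
  rewrite mxE; under eq_fun do rewrite mxE.
  by apply: cvgD; [exact: cvg_gradient_coord|exact: cvg_cst].
apply: cvgM; first exact: cvg_cst.
apply: cvg_sum => j; rewrite expr2; under eq_fun do rewrite expr2.
by apply: cvgM; exact: cvg_residual_coord.
Qed.

(** * Bounds near a limit point *)

Lemma ler_sum_near (R : realType) (I : finType) (T : Type) (F : set_system T)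
    (P : T -> Prop) (h : I -> T -> R) (C : I -> R) : Filter F ->
  (forall i, \forall z \near F, P z -> h i z <= C i) ->
  \forall z \near F, P z -> \sum_i h i z <= \sum_i C i.
Proof.
move=> FF /filter_forall; apply: filterS => z hC Pz.
by apply: ler_sum => i _; exact: hC.
Qed.

(** The bounded sum is the derivative of the squared distance to [(p, q)] along the ODE. Positivity
    is a premise under [\near] because [p] may lie on the boundary of [pos_region]. *)
Lemma squared_distance_speed_bounded (R : realType) (m n : nat)
    (f : 'cV[R]_n -> R) (A : 'M[R]_(m, n)) (b : 'cV[R]_m) (s : nat)
    (gamma sigma1 sigma2 : R)
    (T : Type) (F : set_system T) (X : T -> 'cV[R]_n) (Y : T -> 'cV[R]_m)
    (p : 'cV[R]_n) (q : 'cV[R]_m)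
    (u := fun z (i : 'I_n) => if (i < s)%N then X z i 0 `^ gamma else 1) :
  Filter F -> 0 <= gamma -> differentiable (gradient f) p ->
  X z @[z --> F] --> p -> Y z @[z --> F] --> q ->
  exists2 M : R, 0 < M & \forall z \near F, pos_region s (X z) ->
    \sum_i 2 * (X z i 0 - p i 0) *
      (- (u z i * u z i *
          field_direction f A b sigma1 (X z) (Y z) i 0)) +
    \sum_j 2 * (Y z j 0 - q j 0) * (sigma2 * (A *m X z - b) j 0) <= M.
Proof.
move=> FF g_ge0 gd Xp Yq.
(* Near [p] the coordinate is at most [|p_i| + 1], so [c i] dominates the diagonal entry of [U]. *)
pose c (i : 'I_n) : R := if (i < s)%N then (`|p i 0| + 1) `^ gamma else 1.
have c_ge0 i : 0 <= c i by rewrite /c; case: ifP => // _; exact: powR_ge0.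
exists (\sum_i 2 * (c i * c i) + \sum_(j < m) 1 + 1).
  rewrite ltr_wpDl// addr_ge0// sumr_ge0// => i _.
  by rewrite mulr_ge0// mulr_ge0.
have Xnear : \forall z \near F, pos_region s (X z) ->
    \sum_i 2 * (X z i 0 - p i 0) *
      (- (u z i * u z i *
          field_direction f A b sigma1 (X z) (Y z) i 0)) <=
    \sum_i 2 * (c i * c i).
  apply: ler_sum_near => i.
  pose h z := (X z i 0 - p i 0) *
    field_direction f A b sigma1 (X z) (Y z) i 0.
  have Xi : X z i 0 @[z --> F] --> p i 0 by exact: cvg_coord.
  have h0 : h z @[z --> F] --> 0.
    rewrite -(mul0r (field_direction f A b sigma1 p q i 0)) -(subrr (p i 0)).
    apply: cvgM; last exact: cvg_field_direction_coord.
    by apply: cvgB => //; exact: cvg_cst.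
  have Xle : \forall z \near F, X z i 0 <= `|p i 0| + 1.
    by apply: (cvgr_le (p i 0)) => //; rewrite ltr_pwDr// ler_norm.
  (* Only an upper bound on the speed is sought and [h] enters it with a minus sign, so a lower
     bound on [h] suffices. *)
  have hge : \forall z \near F, -1 <= h z.
    by apply: (cvgr_ge 0) => //; rewrite oppr_lt0.
  near=> z => Xpos.
  have hz_ge : - 1 <= h z by near: z.
  have u_ge0 : 0 <= u z i by rewrite /u; case: ifP => // _; exact: powR_ge0.
  have u_le : u z i <= c i.
    rewrite /u /c; case: ifP => // is_.
    rewrite ge0_ler_powR// ?nnegrE ?addr_ge0 ?(ltW (Xpos i is_))//.
    by near: z.
  have uu_le : u z i * u z i <= c i * c i by rewrite ler_pM.
  have uu_ge0 : 0 <= u z i * u z i by rewrite mulr_ge0.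
  have -> : 2 * (X z i 0 - p i 0) * (- (u z i * u z i *
      field_direction f A b sigma1 (X z) (Y z) i 0)) =
      2 * (u z i * u z i * - h z) by rewrite /h; ring.
  rewrite ler_pM2l//; apply: le_trans uu_le.
  by rewrite ler_piMr// lerNl.
have Ynear : \forall z \near F, pos_region s (X z) ->
    \sum_j 2 * (Y z j 0 - q j 0) * (sigma2 * (A *m X z - b) j 0) <=
    \sum_(j < m) 1.
  apply: ler_sum_near => j.
  pose h z := 2 * (Y z j 0 - q j 0) * (sigma2 * (A *m X z - b) j 0).
  have h0 : h z @[z --> F] --> 0.
    rewrite -(mul0r (sigma2 * (A *m p - b) j 0)) -(mulr0 2) -(subrr (q j 0)).
    apply: cvgM; apply: cvgM; try exact: cvg_cst.
      by apply: cvgB; [exact: cvg_coord|exact: cvg_cst].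
    exact: cvg_residual_coord.
  have : \forall z \near F, h z <= 1 by exact: (cvgr_le 0).
  by apply: filterS.
near=> z => Xpos.
have X_le : \sum_i 2 * (X z i 0 - p i 0) *
      (- (u z i * u z i *
          field_direction f A b sigma1 (X z) (Y z) i 0)) <=
    \sum_i 2 * (c i * c i) by move: Xpos; near: z.
have Y_le : \sum_j 2 * (Y z j 0 - q j 0) * (sigma2 * (A *m X z - b) j 0) <=
    \sum_(j < m) 1 by move: Xpos; near: z.
lra.
Unshelve. all: by end_near. Qed.

(** Balls here are taken in the maximum norm, and each single square is at most the whole sum. *)
Lemma ball_sqr_distance (R : realType) (m n : nat) (p x : 'cV[R]_n)
    (q y : 'cV[R]_m) (e : R) : 0 < e ->
  \sum_i (x i 0 - p i 0) ^+ 2 + \sum_j (y j 0 - q j 0) ^+ 2 < e ^+ 2 ->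
  ball (p, q) e (x, y).
Proof.
move=> e_gt0 qe.
have S_ge0 k (v w : 'cV[R]_k) : 0 <= \sum_i (v i 0 - w i 0) ^+ 2.
  by apply: sumr_ge0 => i _; exact: sqr_ge0.
have lt_ball k (v w : 'cV[R]_k) :
    \sum_i (v i 0 - w i 0) ^+ 2 < e ^+ 2 -> ball w e v.
  move=> vw; split => // i j; rewrite ord1 /ball/= distrC.
  rewrite -(ltr_pXn2r (n := 2)) ?nnegrE ?(ltW e_gt0)//.
  apply: le_lt_trans vw; rewrite real_normK ?num_real// (bigD1 i)//= lerDl.
  by apply: sumr_ge0 => l _; exact: sqr_ge0.
split; apply: lt_ball.
  by have := S_ge0 _ y q; move: qe => /=; lra.
by have := S_ge0 _ x p; move: qe => /=; lra.
Qed.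

(** * The Lyapunov function and its derivative *)

Lemma component_potential (R : realType) (n s : nat) (gamma : R)
    (a : 'cV[R]_n) : 2^-1 <= gamma < 1 ->
  (forall i : 'I_n, (i < s)%N -> 0 <= a i 0) ->
  exists (phi : 'I_n -> R -> R) (B : 'I_n -> R), forall (i : 'I_n) (v : R),
    ((i < s)%N -> 0 < v) -> B i <= phi i v /\
    is_derive v 1 (phi i) ((v - a i 0) /
      ((if (i < s)%N then v `^ gamma else 1) *
       (if (i < s)%N then v `^ gamma else 1))).
Proof.
move=> g12 a_ge0.
have /choice[g gP] : forall i : 'I_n, exists g : (R -> R) * R, forall v : R,
    ((i < s)%N -> 0 < v) -> g.2 <= g.1 v /\
    is_derive v 1 g.1 ((v - a i 0) /
      ((if (i < s)%N then v `^ gamma else 1) *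
       (if (i < s)%N then v `^ gamma else 1))).
  move=> i; have [is_|_] := boolP (i < s)%N.
    have [phi [B phiP]] := powR_lyapunov _ _ _ g12 (a_ge0 i is_).
    by exists (phi, B) => v /(_ isT); exact: phiP.
  (* For a free coordinate [u = 1], so the potential is quadratic. *)
  exists (fun v => 2^-1 * (v - a i 0) ^+ 2, 0) => v _ /=; split.
    by rewrite mulr_ge0 ?sqr_ge0.
  have := is_derive_sqr_subr _ id 1 (a i 0) v (is_derive_id _ _) => d.
  by apply: is_derive_eq; rewrite -![_ *: _]/(_ * _) /=; field.
by exists (fun i => (g i).1), (fun i => (g i).2).
Qed.

(** In the chain rule [u_i^2] from the ODE cancels [1 / u_i^2] from [phi_i'], and the weight
    [(2 * sigma2)^-1] makes the [y]-part cancel the cross term of [field_direction_dot]. *)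
Lemma lyapunov_derivative (R : realType) (m n : nat)
    (f : 'cV[R]_n -> R) (A : 'M[R]_(m, n)) (b : 'cV[R]_m) (s : nat)
    (gamma sigma1 sigma2 : R) (x : R -> 'cV[R]_n) (y : R -> 'cV[R]_m)
    (a : 'cV[R]_n) (ya : 'cV[R]_m) (phi : 'I_n -> R -> R) (t : R)
    (u := fun i : 'I_n => if (i < s)%N then x t i 0 `^ gamma else 1) :
  sigma2 != 0 -> A *m a = b -> pos_region s (x t) ->
  (forall i, is_derive (x t i 0) 1 (phi i) ((x t i 0 - a i 0) / (u i * u i))) ->
  (forall i, is_derive t 1 (fun r => x r i 0)
     (- (u i * u i * field_direction f A b sigma1 (x t) (y t) i 0))) ->
  (forall j, is_derive t 1 (fun r => y r j 0) (sigma2 * (A *m x t - b) j 0)) ->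
  is_derive t 1 (fun r => \sum_i phi i (x r i 0) +
      (2 * sigma2)^-1 * \sum_j (y r j 0 - ya j 0) ^+ 2)
    (- dissipation f A b sigma1 a ya (x t)).
Proof.
move=> s2_neq0 Aa xpos phid xd yd.
have u_neq0 i : u i != 0.
  by rewrite /u; case: ifP => [is_|_]; rewrite ?oner_neq0// gt_eqF// powR_gt0// xpos.
have Xd := is_derive_sumE _ _ (fun i r => phi i (x r i 0)) _ t
  (fun i => is_derive1_comp (phid i) (xd i)).
have Yd := is_derive_sumE _ _ (fun j r => (y r j 0 - ya j 0) ^+ 2) _ t
  (fun j => is_derive_sqr_subr _ _ _ (ya j 0) t (yd j)).
apply: is_derive_eq; rewrite -![_ *: _]/(_ * _).
have -> : \sum_i (x t i 0 - a i 0) / (u i * u i) *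
    - (u i * u i * field_direction f A b sigma1 (x t) (y t) i 0) =
    - \sum_i (x t i 0 - a i 0) * field_direction f A b sigma1 (x t) (y t) i 0.
  by rewrite -sumrN; apply: eq_bigr => i _; field.
rewrite (field_direction_dot _ _ _ _ _ _ _ a _ ya)//.
have -> : \sum_j 2 * (y t j 0 - ya j 0) * (sigma2 * (A *m x t - b) j 0) =
    2 * sigma2 * \sum_j (y t j 0 - ya j 0) * (A *m x t - b) j 0.
  by rewrite mulr_sumr; apply: eq_bigr => j _; ring.
rewrite mulKf ?mulf_neq0 ?pnatr_eq0//; ring.
Qed.

(** * Optimality of limit points *)

Theorem theorem3p2 (R : realType) (m n : nat)
    (f : 'cV[R]_n -> R)
    (f_convex : convex_function [set: 'cV[R]_n] f)
    (f_C2 : twice_continuously_differentiable f)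
    (A : 'M[R]_(m, n)) (A_full_row_rank : \rank A = m)
    (b : 'cV[R]_m)
    (s : nat) (s_le_n : (s <= n)%N)
    (gamma : R) (gamma_bounds : 2^-1 <= gamma < 1)
    (t0 : R) (t0_ge0 : 0 <= t0)
    (sigma1 : R) (sigma1_gt0 : 0 < sigma1)
    (sigma2 : R) (sigma2_gt0 : 0 < sigma2)
    (P_solvable : exists xstar, optimal_solution f A b s xstar)
    (x0 : 'cV[R]_n) (y0 : 'cV[R]_m) (x0_pos : pos_region s x0)
    (x : R -> 'cV[R]_n) (y : R -> 'cV[R]_m)
    (xy_solution : ode_solution f A b s gamma t0 sigma1 sigma2 x0 y0 x y)
    (p1 : 'cV[R]_n) (p2 : 'cV[R]_m) (p_limit : limit_set x y (p1, p2)) :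
  optimal_solution f A b s p1.
Proof.
have [fd gd _] := f_C2; have [a a_opt] := P_solvable.
have [[Aa a_ge0] _] := a_opt.
have [ya kkt] := kkt_multiplier _ _ _ _ _ _ _ _ a_opt (fd a).
have [xpos [xder _] _ [yder _] _] := xy_solution.
have [t_ t_inf t_cvg] := p_limit.
have x_cvg : x (t_ k) @[k --> \oo] --> p1.
  by apply: cvg_comp t_cvg cvg_fst.
have y_cvg : y (t_ k) @[k --> \oo] --> p2.
  by apply: cvg_comp t_cvg cvg_snd.
have p1_ge0 (i : 'I_n) : (i < s)%N -> 0 <= p1 i 0.
  move=> is_; have xi : x (t_ k) i 0 @[k --> \oo] --> p1 i 0 by exact: cvg_coord.
  rewrite -(cvg_lim _ xi)//; apply: limr_ge; first by apply/cvg_ex; exists (p1 i 0).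
  near=> k; apply/ltW/xpos => //; apply/ltW.
  by near: k; exact: cvgry_gt.
have x_ge0 t : t0 < t -> forall i : 'I_n, (i < s)%N -> 0 <= x t i 0.
  by move=> /ltW t0t i is_; apply/ltW/xpos.
pose W := dissipation f A b sigma1 a ya.
have W_ge0 (z : 'cV_n) : (forall i : 'I_n, (i < s)%N -> 0 <= z i 0) -> 0 <= W z.
  by move=> z_ge0; apply: dissipation_ge0 => //; [exact: ltW|exact: kkt].
(* A zero of [W] is optimal; the case [W p1 > 0] is refuted below. *)
have [W0|W_neq0] := eqVneq (W p1) 0.
  apply: (dissipation_eq0_optimal _ _ _ _ _ _ _ _ _ _ _ _ _ sigma1_gt0 a_opt _ p1_ge0 W0) => //.
  exact: kkt.
have W_gt0 : 0 < W p1 by rewrite lt_neqAle eq_sym W_neq0 W_ge0.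
pose u t (i : 'I_n) := if (i < s)%N then x t i 0 `^ gamma else 1.
pose G t i := field_direction f A b sigma1 (x t) (y t) i 0.
have xd t i : t0 < t ->
    is_derive t 1 (fun r => x r i 0) (- (u t i * u t i * G t i)).
  move=> t0t; have := is_derive_coord _ _ _ _ _ _ i 0 (xder t t0t).
  by rewrite [(- (_ *m _)) _ _]mxE Umx_mulmxE.
have yd t j : t0 < t ->
    is_derive t 1 (fun r => y r j 0) (sigma2 * (A *m x t - b) j 0).
  move=> t0t; have := is_derive_coord _ _ _ _ _ _ j 0 (yder t t0t).
  by rewrite [(_ *: (A *m _ - _)) _ _]mxE.
have [phi [B phiP]] := component_potential _ _ s _ a gamma_bounds a_ge0.
pose V t := \sum_i phi i (x t i 0) +
  (2 * sigma2)^-1 * \sum_j (y t j 0 - ya j 0) ^+ 2.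
have Vd t : t0 < t -> is_derive t 1 V (- W (x t)).
  move=> t0t; have xt := xpos t (ltW t0t).
  apply: (lyapunov_derivative _ _ _ _ _ _ s gamma sigma1 sigma2) => //.
  - by rewrite gt_eqF.
  - by move=> i; apply: (phiP i _ _).2; exact: xt.
  - by move=> i; exact: xd.
  - by move=> j; exact: yd.
have V_ge t : t0 < t -> \sum_i B i <= V t.
  move=> t0t; rewrite -[leLHS]addr0 lerD//.
    by apply: ler_sum => i _; apply: (phiP i _ _).1; exact: (xpos t (ltW t0t)).
  rewrite mulr_ge0 ?invr_ge0 ?mulr_ge0 ?(ltW sigma2_gt0)// sumr_ge0// => j _.
  exact: sqr_ge0.
pose q t := \sum_i (x t i 0 - p1 i 0) ^+ 2 + \sum_j (y t j 0 - p2 j 0) ^+ 2.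
pose dq t := \sum_i 2 * (x t i 0 - p1 i 0) * (- (u t i * u t i * G t i)) +
  \sum_j 2 * (y t j 0 - p2 j 0) * (sigma2 * (A *m x t - b) j 0).
have qd t : t0 < t -> is_derive t 1 q (dq t).
  move=> t0t; apply: is_deriveD; apply: is_derive_sumE => i;
    apply: is_derive_sqr_subr; [exact: xd|exact: yd].
have g_ge0 : 0 <= gamma by move/andP: gamma_bounds => [? _]; lra.
(* The bounds are taken over neighbourhoods of [(p1, p2)] in phase space, so they hold at every
   visit of the trajectory, whatever its time. *)
have fst_cvg : z.1 @[z --> (p1, p2)] --> p1 by exact: cvg_fst.
have snd_cvg : z.2 @[z --> (p1, p2)] --> p2 by exact: cvg_snd.
have [M M_gt0 dq_near] := squared_distance_speed_bounded _ _ _ f A b s gamma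
  sigma1 sigma2 _ _ _ _ _ _ _ g_ge0 (gd p1) fst_cvg snd_cvg.
have W_cvg : W z.1 @[z --> (p1, p2)] --> W p1 by exact: cvg_dissipation.
have W_half : W p1 / 2 < W p1 by lra.
have W_near : \forall z \near (p1, p2), W p1 / 2 <= W z.1.
  exact: (cvgr_ge _ W_cvg).
(* One radius [e] serves both the lower bound on [W] and the speed bound. *)
have [e /= e_gt0 e_ball] := (nbhs_ballP _ _).1 (filterI W_near dq_near).
have in_ball t : q t < e ^+ 2 -> ball (p1, p2) e (x t, y t).
  by move=> qt; exact: ball_sqr_distance.
have [|||||||T t0T q_ge] := descent_leaves_sublevel _ t0 (e ^+ 2) (W p1 / 2) M
  (\sum_i B i) V (fun t => - W (x t)) q dq.
all: try assumption.
- by rewrite exprn_gt0.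
- by rewrite divr_gt0.
- by move=> t t0t; rewrite oppr_le0 W_ge0//; exact: x_ge0.
- by move=> t t0t /in_ball/e_ball[/= Wt _]; rewrite lerN2.
- by move=> t t0t /in_ball/e_ball[/= _]; apply; exact: (xpos t (ltW t0t)).
(* Along [t_] the squared distance tends to 0, against the eventual bound [e ^+ 2 / 2 <= q]. *)
have q_cvg : q (t_ k) @[k --> \oo] --> 0.
  have sq0 l (v : nat -> 'cV[R]_l) (w : 'cV[R]_l) : v k @[k --> \oo] --> w ->
      \sum_i (v k i 0 - w i 0) ^+ 2 @[k --> \oo] --> 0.
    move=> vw.
    have d0 i : v k i 0 - w i 0 @[k --> \oo] --> (0 : R).
      by rewrite -(subrr (w i 0)); apply: cvgB; [exact: cvg_coord|exact: cvg_cst].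
    have dd0 i : (v k i 0 - w i 0) ^+ 2 @[k --> \oo] --> (0 : R).
      by rewrite -(mulr0 (0 : R)); under eq_fun do rewrite expr2; exact: cvgM.
    have := @cvg_sum _ _ _ \oo (fun i k => (v k i 0 - w i 0) ^+ 2) (fun=> 0) _ dd0.
    by rewrite big1// => h; exact: h.
  by rewrite -[0]addr0; apply: cvgD; exact: sq0.
have e2_gt0 : 0 < e ^+ 2 / 2 by rewrite divr_gt0// exprn_gt0.
have T_near : \forall k \near \oo, T < t_ k by exact: (cvgry_gt t_inf).
have q_near : \forall k \near \oo, q (t_ k) < e ^+ 2 / 2.
  exact: (cvgr_lt _ q_cvg).
have [k [/ltW Tk qk]] := filter_ex (filterI T_near q_near).
by have := q_ge _ Tk; rewrite leNgt qk.
Unshelve. all: by end_near. Qed.
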